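(* Let $n$ be a positive integer and $\zeta_n$ a primitive $n$-th root of unity. For any nonnegative integer $l$, we have $$\overline{z}_n^t(\{1\}^l;\zeta_n)=\sum_{m=0}^l\frac{(-1)^m}{n^{m+1}}\sum_{\substack{i_0+\cdots+i_m=l\\ 0\leq i_0\leq n-1\\ 1\leq i_1,\ldots,i_m\leq n-1}}\prod_{a=0}^m\binom{n}{i_a+1}\,(1-t)^{i_0}(-t)^{l-i_0},$$ $$\overline{z}_n^t(\{2\}^l;\zeta_n)=\sum_{m=0}^l\frac{(-1)^m}{n^{m+1}}\sum_{\substack{i_0+\cdots+i_m=l\\ 0\leq i_0\leq n-1\\ 1\leq i_1,\ldots,i_m\leq n-1}}\prod_{a=0}^m\frac{1}{i_a+1}\binom{n+i_a}{2i_a+1}\,(t-1)^{i_0}t^{l-i_0},$$ $$\overline{z}_n^t(\{3\}^l;\zeta_n)=\sum_{m=0}^l\frac{(-1)^m}{n^{2m+2}}\sum_{\substack{i_0+\cdots+i_m=l\\ 0\leq i_0\leq n-1\\ 1\leq i_1,\ldots,i_m\leq n-1}}\prod_{a=0}^m\frac{1}{i_a+1}\left[\binom{n+i_a}{3i_a+2}+(-1)^{i_a}\binom{n+2i_a+1}{3i_a+2}\right](t-1)^{i_0}t^{l-i_0},$$ where in each formula the factors $(1-t)^{i_0}(-t)^{l-i_0}$, respectively $(t-1)^{i_0}t^{l-i_0}$, are outside the product over $a$.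
   Context: $\mathbb{N}$ is the set of positive integers and $t$ is a formal parameter. For a multi-index $\mathbf{k}=(k_1,\ldots,k_l)\in\mathbb{N}^l$ the depth is $\mathrm{dep}(\mathbf{k})=l$. The symbol $\{k\}^l$ denotes $k$ repeated $l$ times. Let $q$ be a complex number with $q^m\ne1$ for every positive integer $m<n$ (e.g. $q=\zeta_n$). For $\mathbf{k}\in\mathbb{N}^l$ with $l\ge 1$, $$\overline{z}_n(\mathbf{k};q)=\sum_{n>m_1>\cdots>m_l>0}\frac{q^{(k_1-1)m_1+\cdots+(k_l-1)m_l}}{(1-q^{m_1})^{k_1}\cdots(1-q^{m_l})^{k_l}},$$ and its interpolated version is $$\overline{z}_n^t(\mathbf{k};q)=\sum_{\mathbf{p}}\overline{z}_n(\mathbf{p};q)\,t^{l-\mathrm{dep}(\mathbf{p})},$$ where the sum runs over all $3^{l-1}$ ways of forming $\mathbf{p}=(k_1\Box\cdots\Box k_l)$ by filling each $\Box$ with '','' (comma), ''$+$'' or ''$-1+$''. For the empty multi-index ($l=0$) the value is $1$. Binomial coefficients $\binom{N}{M}$ with $0\le N<M$ are $0$. *)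

(* Defs.v *)
From HB Require Import structures.
From mathcomp Require Import all_boot all_order all_algebra.
From mathcomp Require Import complex reals.

Set Implicit Arguments.
Unset Strict Implicit.
Unset Printing Implicit Defensive.

Import GRing.Theory.

Local Open Scope ring_scope.

(* Multi-indices are sequences of natural numbers, meant to have positive
   entries. *)

Section BarredSums.
Variable F : fieldType.

(* m ranges over the families n > m_1 > ... > m_l > 0, so that the sum is 1
   for the empty multi-index.  Since the entries of k are positive,
   (k_j).-1 is k_j - 1.  The denominators are meant to be nonzero, that is
   q ^+ j != 1 for 0 < j < n. *)
Definition zbar (n : nat) (k : seq nat) (q : F) : F :=
  \sum_(m : {ffun 'I_(size k) -> 'I_n} |
          [forall j, (0 < m j)%N]
          && [forall i : 'I_(size k),
              forall j : 'I_(size k), (i < j)%N ==> (m j < m i)%N])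
    q ^+ (\sum_(j < size k) (nth 0%N k j).-1 * m j)%N
    / \prod_(j < size k) (1 - q ^+ m j) ^+ nth 0%N k j.

End BarredSums.

(* The possible contents of a box: ",", "+" or "-1+". *)
Inductive box := Comma | Plus | MinusOnePlus.

Definition box_code (b : box) : option bool :=
  match b with
  | Comma => None
  | Plus => Some true
  | MinusOnePlus => Some false
  end.

Definition box_decode (c : option bool) : box :=
  match c with
  | None => Comma
  | Some true => Plus
  | Some false => MinusOnePlus
  end.

Lemma box_codeK : cancel box_code box_decode.
Proof. by case. Qed.

HB.instance Definition _ := Finite.copy box (can_type box_codeK).

(* fill k1 [:: (b_2, k_2); ...; (b_l, k_l)] is the multi-index
   (k1 b_2 k_2 b_3 ... b_l k_l). *)
Fixpoint fill (k1 : nat) (s : seq (box * nat)) : seq nat :=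
  match s with
  | [::] => [:: k1]
  | (Comma, k2) :: s' => k1 :: fill k2 s'
  | (Plus, k2) :: s' => fill (k1 + k2)%N s'
  | (MinusOnePlus, k2) :: s' => fill (k1 - 1 + k2)%N s'
  end.

(* The formal parameter t is the variable 'X. *)
Definition zbar_t (F : fieldType) (n : nat) (k : seq nat) (q : F) : {poly F} :=
  if k is k1 :: ks then
    \sum_(b : (size ks).-tuple box)
      let p := fill k1 (zip b ks) in
      zbar n p q *: 'X^(size k - size p)
  else 1.

(* The families (i_0, ..., i_m) with i_0 + ... + i_m = l,
   0 <= i_0 <= n - 1 and 1 <= i_1, ..., i_m <= n - 1. *)
Definition sum_indices (n l m : nat) : {set {ffun 'I_m.+1 -> 'I_n}} :=
  [set i : {ffun 'I_m.+1 -> 'I_n} |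
     ((\sum_(a < m.+1) i a)%N == l)
      && [forall a, (a != ord0) ==> (0 < i a)%N]].

(* Main.v *)
Require Import Defs.
From mathcomp Require Import all_boot all_order all_algebra.
From mathcomp Require Import complex reals ring.

(* Put f_m = zeta^((k-1)m) / (1 - zeta^m)^k.  Merging r consecutive k's at the
   same m, with every choice of "+" and "-1+", contributes t^(r-1) f_m^r, so
   the generating series of the interpolated sums is
     sum_l zbar_t({k}^l) X^l
       = prod_(0<m<n) (1 + (1-t) f_m X) / (1 - t f_m X).
   With E(c) = prod_(0<m<n) (1 + f_m c) this is E((1-t)X) / E(-tX), and the
   multiple sums of the theorem come from expanding 1 / E(-tX) as a geometric
   series in 1 - E(-tX).  The coefficients of E are obtained by evaluation:
   factoring (1-x)^k - c x^(k-1) as a product of factors 1 - a x turns the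
   product over the n-th roots of unity into prod_a (1 - a^n).  For k <= 3 this
   is a combination of power sums of the roots of (x-1)^k = c x^s, which are
   determined by their recurrence in n. *)

Set Implicit Arguments.
Unset Strict Implicit.
Unset Printing Implicit Defensive.

Import GRing.Theory.

Local Open Scope ring_scope.

(** * Multiple sums as sums of weights, and peeling off the largest variable *)

Definition weight (F : fieldType) (q : F) (k x : nat) : F :=
  q ^+ (k.-1 * x) / (1 - q ^+ x) ^+ k.

(** Over the denominator (1-q^x)^(a+b) the second numerator is q^((a+b-2)x) (1-q^x), whose negative
    part cancels the first numerator. Hence [Plus] and [MinusOnePlus] are always treated
    together. *)
Lemma weight_merge (F : fieldType) (q : F) (a b x : nat) :
  (0 < a)%N -> (0 < b)%N -> 1 - q ^+ x != 0 ->
  weight q (a + b) x + weight q (a - 1 + b) x = weight q a x * weight q b x.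
Proof.
case: a b => [//|a] [//|b] _ _ y0.
rewrite /weight subn1 /= !addnS !addSn /= !mulSn mulnDl !exprD !exprS !exprD.
by field; rewrite y0 !expf_neq0.
Qed.

(* zbar with the upper bound n separated from the type 'I_K of the summation
   variables, so that the largest variable can be peeled off. *)
Definition zbelow (F : fieldType) (q : F) (K n : nat) (k : seq nat) : F :=
  \sum_(f : {ffun 'I_(size k) -> 'I_K} |
          [forall j, (0 < f j < n)%N]
          && [forall i : 'I_(size k),
              forall j : 'I_(size k), (i < j)%N ==> (f j < f i)%N])
    \prod_(j < size k) weight q (nth 0%N k j) (f j).

Lemma zbarE (F : fieldType) (q : F) (n : nat) (k : seq nat) :
  zbar n k q = zbelow q n n k.
Proof.
apply: eq_big => [f|f _].
  by congr (_ && _); apply: eq_forallb => j; rewrite ltn_ord andbT.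
by rewrite /weight big_split /= prodfV prodrXr.
Qed.

Lemma zbelow_nil (F : fieldType) (q : F) (K n : nat) : zbelow q K n [::] = 1.
Proof.
rewrite /zbelow (big_pred1 (ffun0 (card_ord 0))) ?big_ord0 //.
move=> f; rewrite [RHS](_ : _ = true); last by apply/eqP/ffunP => -[].
by apply/andP; split; apply/forallP => -[].
Qed.

Definition ffcons (T : finType) (l : nat) (p : T * {ffun 'I_l -> T}) :
    {ffun 'I_l.+1 -> T} :=
  [ffun i => if unlift ord0 i is Some j then p.2 j else p.1].

Lemma ffcons0 (T : finType) (l : nat) (p : T * {ffun 'I_l -> T}) :
  ffcons p ord0 = p.1.
Proof. by rewrite ffunE unlift_none. Qed.

Lemma ffconsS (T : finType) (l : nat) (p : T * {ffun 'I_l -> T}) (j : 'I_l) :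
  ffcons p (lift ord0 j) = p.2 j.
Proof. by rewrite ffunE liftK. Qed.

Lemma ffcons_bij (T : finType) (l : nat) : bijective (@ffcons T l).
Proof.
pose uncons (f : {ffun 'I_l.+1 -> T}) := (f ord0, [ffun j => f (lift ord0 j)]).
exists uncons => [[x g]|f]; rewrite /uncons.
  by rewrite ffcons0; congr pair; apply/ffunP => j; rewrite ffunE ffconsS.
apply/ffunP => i; case: (unliftP ord0 i) => [j|] ->.
  by rewrite ffconsS ffunE.
by rewrite ffcons0.
Qed.

Lemma zbelow_cons (F : fieldType) (q : F) (K n a : nat) (k : seq nat) :
  zbelow q K n (a :: k) =
  \sum_(x < K | (0 < x < n)%N) weight q a x * zbelow q K x k.
Proof.
rewrite /zbelow (reindex _ (onW_bij _ (ffcons_bij _ _))) /=.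
under [RHS]eq_bigr do rewrite mulr_sumr.
rewrite pair_big_dep /=; apply: eq_big => [[x g]|[x g] _] /=; last first.
  rewrite big_ord_recl ffcons0; congr (_ * _).
  by apply: eq_bigr => j _; rewrite ffconsS.
apply/andP/and3P => [[/forallP fn /forallP fd]|[xn /forallP gx /forallP gd]].
  have := fn ord0; rewrite ffcons0 /= => xn; split=> //; apply/forallP => j.
    have := fn (lift ord0 j); rewrite ffconsS => /andP[-> _] /=.
    by have /forallP/(_ (lift ord0 j)) := fd ord0; rewrite ffconsS ffcons0.
  apply/forallP => j'; have /forallP/(_ (lift ord0 j')) := fd (lift ord0 j).
  by rewrite !ffconsS /= !/bump /= !add1n ltnS.
split; apply/forallP => i.
  case: (unliftP ord0 i) => [j|] ->; rewrite ?ffcons0 // ffconsS.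
  have /andP[-> gjx] := gx j; case/andP: xn => _ xn.
  exact: ltn_trans xn.
apply/forallP => j.
case: (unliftP ord0 j) => [j'|] ->; rewrite ?ltn0 //.
case: (unliftP ord0 i) => [i'|] ->; rewrite ?ffcons0 !ffconsS.
  by have /forallP/(_ j') := gd i'; rewrite /= !/bump /= !add1n ltnS.
by have /andP[_ ->] := gx j'; rewrite implybT.
Qed.

Lemma zbelow1_cons (F : fieldType) (q : F) (K a : nat) (k : seq nat) :
  zbelow q K 1 (a :: k) = 0.
Proof. by rewrite zbelow_cons big1 // => x; case: (nat_of_ord x). Qed.

Lemma zbelowS_cons (F : fieldType) (q : F) (K n a : nat) (k : seq nat) :
  (0 < n < K)%N ->
  zbelow q K n.+1 (a :: k) =
  zbelow q K n (a :: k) + weight q a n * zbelow q K n k.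
Proof.
case/andP=> n0 nK; rewrite !zbelow_cons (bigD1 (Ordinal nK)) /=; last first.
  by rewrite n0 ltnSn.
rewrite addrC; congr (_ + _); apply: eq_bigl => x.
by rewrite -val_eqE /= ltnS (ltn_neqAle x n) andbAC -andbA.
Qed.

(** * Recurrence in n for the interpolated sums of a repeated index *)

Lemma sum_box (V : nmodType) (f : box -> V) :
  \sum_b f b = f Comma + (f Plus + f MinusOnePlus).
Proof.
rewrite (bigD1 Comma) //= (bigD1 Plus) //= (bigD1 MinusOnePlus) //=.
by rewrite big1 ?addr0 // => -[].
Qed.

Lemma sum_tupleS (T : finType) (V : nmodType) (l : nat)
    (f : l.+1.-tuple T -> V) :
  \sum_b f b = \sum_x \sum_(b : l.-tuple T) f [tuple of x :: b].
Proof.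
rewrite pair_big /=.
rewrite (reindex (fun p : T * l.-tuple T => [tuple of p.1 :: p.2])) //=.
exists (fun b => (thead b, [tuple of behead b])) => [[x b] _|b _] /=.
  by congr pair; apply: val_inj.
by rewrite -tuple_eta.
Qed.

Lemma size_fill (k1 : nat) (s : seq (box * nat)) :
  (0 < size (fill k1 s) <= (size s).+1)%N.
Proof.
elim: s k1 => [|[[] k2] s IH] k1 //=; first by have /andP[] := IH k2.
  by case/andP: (IH (k1 + k2)%N) => -> /leqW ->.
by case/andP: (IH (k1 - 1 + k2)%N) => -> /leqW ->.
Qed.

Section RepeatedIndex.

Variables (F : fieldType) (q : F) (K k : nat).
Hypothesis k_gt0 : (0 < k)%N.

(* The interpolated sum of (k1, k, ..., k) with l copies of k: merging changes
   the first entry only, so it has to be generalized from k. *)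
Definition head_sum (n k1 l : nat) : {poly F} :=
  \sum_(b : l.-tuple box)
    let p := fill k1 (zip b (nseq l k)) in
    zbelow q K n p *: 'X^(l.+1 - size p).

Definition rep_sum (n l : nat) : {poly F} :=
  if l is l'.+1 then head_sum n k l' else 1.

Lemma zbar_tE (l : nat) : zbar_t K (nseq l k) q = rep_sum K l.
Proof.
case: l => [//|l]; rewrite /zbar_t /= /head_sum size_nseq.
by apply: eq_bigr => b _; rewrite zbarE.
Qed.

Lemma head_sum0 (n k1 : nat) : head_sum n k1 0 = (zbelow q K n [:: k1])%:P.
Proof.
rewrite /head_sum (big_pred1 [tuple]) => [|b].
  by rewrite /= expr0 alg_polyC.
by apply/esym/eqP; exact: tuple0.
Qed.

Lemma head_sumS (n k1 l : nat) :
  head_sum n k1 l.+1 =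
  \sum_(b : l.-tuple box)
    (let p := fill k (zip b (nseq l k)) in
     zbelow q K n (k1 :: p) *: 'X^(l.+1 - size p))
  + 'X * (head_sum n (k1 + k) l + head_sum n (k1 - 1 + k) l).
Proof.
rewrite {1}/head_sum sum_tupleS sum_box; congr (_ + _).
rewrite mulrDr /head_sum !mulr_sumr; congr (_ + _); apply: eq_bigr => b _ /=.
  (* A merge lowers the depth: by [size_fill] the subtraction in the exponent is not truncated, and
     one extra factor 'X comes out. *)
  rewrite subSn; last first.
    case/andP: (size_fill (k1 + k)%N (zip b (nseq l k))) => _.
    by rewrite size_zip size_tuple size_nseq minnn.
  by rewrite exprS scalerAr.
rewrite subSn; last first.
  case/andP: (size_fill (k1 - 1 + k)%N (zip b (nseq l k))) => _.
  by rewrite size_zip size_tuple size_nseq minnn.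
by rewrite exprS scalerAr.
Qed.

Lemma rep_sum1 (l : nat) : rep_sum 1 l = (l == 0)%:R.
Proof.
case: l => [//|l] /=; rewrite /head_sum big1 // => b _ /=.
case: fill (size_fill k (zip b (nseq l k))) => [//|a p] _.
by rewrite zbelow1_cons scale0r.
Qed.

(* The contribution of the terms whose largest variable is n, divided by the
   weight of k1 at n. *)
Fixpoint head_step (n l : nat) : {poly F} :=
  if l is l'.+1 then
    rep_sum n l + (weight q k n *: 'X) * head_step n l'
  else 1.

(** Induction on l for all k1 at once. By [weight_merge] the two ways of merging together contribute
    weight k1 times weight k, so the cofactor of weight k1 is the same for every k1. *)
Lemma head_sum_step (n k1 l : nat) :
  (0 < n < K)%N -> 1 - q ^+ n != 0 -> (0 < k1)%N ->
  head_sum n.+1 k1 l = head_sum n k1 l + weight q k1 n *: head_step n l.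
Proof.
move=> nK qn0; elim: l k1 => [|l IH] k1 k1_gt0.
  by rewrite !head_sum0 zbelowS_cons // zbelow_nil mulr1 polyCD /= alg_polyC.
rewrite !head_sumS !IH ?addn_gt0 ?k_gt0 ?orbT //.
rewrite [head_step n l.+1]/= [in LHS]/head_sum.
under eq_bigr => b _ do rewrite /= zbelowS_cons // scalerDl -scalerA.
rewrite big_split /= -scaler_sumr.
set S := \sum_b _; set T := \sum_b _.
have -> : 'X * (head_sum n (k1 + k) l + weight q (k1 + k) n *: head_step n l +
   (head_sum n (k1 - 1 + k) l + weight q (k1 - 1 + k) n *: head_step n l)) =
   'X * (head_sum n (k1 + k) l + head_sum n (k1 - 1 + k) l) +
   (weight q k1 n * weight q k n) *: ('X * head_step n l).
  by rewrite -weight_merge // addrACA -scalerDl mulrDr -scalerAr.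
by rewrite -scalerA scalerDr -scalerAl; apply: addrACA.
Qed.

(** Eliminates [head_step] between the steps for l+1 and l. With w the weight at n, this is
    multiplication of the generating series by (1 + w(1-t)X) / (1 - wtX), read off
    coefficientwise. *)
Lemma rep_sum_step (n l : nat) : (0 < n < K)%N -> 1 - q ^+ n != 0 ->
  rep_sum n.+1 l.+1 - weight q k n *: 'X * rep_sum n.+1 l =
  rep_sum n l.+1 + weight q k n *: (1 - 'X) * rep_sum n l.
Proof.
move=> nK qn0; case: l => [|l] /=; rewrite !head_sum_step //=.
  by rewrite !mulr1 scalerBr addrA.
rewrite -!mul_polyC; ring.
Qed.

End RepeatedIndex.

(** * Generating series and its expansion into sums over i_0, ..., i_m *)

Lemma coefM_eq_upto (T : nzRingType) (L : nat) (p p' r : {poly T}) :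
  (forall i, (i <= L)%N -> p`_i = p'`_i) ->
  forall i, (i <= L)%N -> (r * p)`_i = (r * p')`_i.
Proof.
move=> pp' i iL; rewrite !coefM; apply: eq_bigr => j _; congr (_ * _).
by apply: pp'; rewrite (leq_trans (leq_subr _ _)).
Qed.

(* The generating series modulo 'X^(L+1), with the denominators cleared. *)
Lemma rep_sum_series (F : fieldType) (q : F) (K k L N : nat) :
  (0 < k)%N -> (forall m, (0 < m < K)%N -> 1 - q ^+ m != 0) -> (0 < N <= K)%N ->
  forall l, (l <= L)%N ->
  (\prod_(1 <= m < N) (1 - (weight q k m *: 'X)%:P * 'X)
     * \poly_(l < L.+1) rep_sum q K k N l)`_l =
  (\prod_(1 <= m < N) (1 + (weight q k m *: (1 - 'X))%:P * 'X))`_l.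
Proof.
move=> k_gt0 qn0; elim: N => [//|[|N] IH] /andP[_ NK] l lL.
  by rewrite !big_geq // mul1r coef_poly ltnS lL rep_sum1 coef1.
have NK' : (0 < N.+1 < K)%N by [].
rewrite (big_nat_recr N.+1 1%N) // (big_nat_recr N.+1 1%N) //= -mulrA.
(* Up to degree L, the last denominator factor times the new series is the last numerator factor
   times the old one; this is [rep_sum_step]. *)
rewrite (@coefM_eq_upto _ L _
  ((1 + (weight q k N.+1 *: (1 - 'X))%:P * 'X) * \poly_(l < L.+1) rep_sum q K k N.+1 l)) //.
  rewrite mulrCA [in RHS]mulrC; apply: coefM_eq_upto lL => i iL.
  by apply: IH => //; apply: ltnW.
move=> i iL; rewrite mulrBl mulrDl !mul1r coefB coefD -!mulrA !coefCM !coefXM.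
rewrite !coef_poly !ltnS iL; case: i iL => [|i] iL /=; first by rewrite !mulr0 subr0 addr0.
by rewrite ltnW //; apply: rep_sum_step; rewrite ?qn0.
Qed.

(** Geometric series for Z = A / B. It may stop at m = L because 1 - B is divisible by 'X, so the
    remainder (1 - B)^(L+1) does not reach degree L. *)
Lemma coef_quotient (T : comNzRingType) (L : nat) (A B Z : {poly T}) :
  B`_0 = 1 -> (forall i, (i <= L)%N -> (B * Z)`_i = A`_i) ->
  Z`_L = \sum_(m < L.+1) (A * (1 - B) ^+ m)`_L.
Proof.
move=> B0 BZ; rewrite -coef_sum -mulr_sumr mulrC.
rewrite -(coefM_eq_upto _ BZ) // mulrA.
have -> : (\sum_(m < L.+1) (1 - B) ^+ m) * B = 1 - (1 - B) ^+ L.+1.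
  have := subrX1 (1 - B) L.+1.
  by move=> E; rewrite -[RHS]opprB E -mulNr opprB subKr mulrC.
have /factor_theorem[Q ->] : root (1 - B) 0.
  by rewrite /root horner_coef0 coefB coef1 B0 subrr.
by rewrite subr0 mulrBl mul1r coefB exprMn mulrAC coefMXn ltnSn subr0.
Qed.

(** In {poly {poly F}} the inner variable is t and the outer one marks l. The ring morphism [phi]
    substitutes u times the outer variable into the given identity over F. *)
Lemma rescaled_product (F : fieldType) (n : nat) (f g : nat -> F)
    (u : {poly F}) :
  \prod_(1 <= m < n) (1 + f m *: 'X) = \poly_(i < n) g i ->
  \prod_(1 <= m < n) (1 + (f m *: u)%:P * 'X) =
  \sum_(i < n) (g i *: u ^+ i)%:P * 'X^i.
Proof.
move=> fg; pose phi (p : {poly F}) := map_poly polyC p \Po (u%:P * 'X).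
have -> : \prod_(1 <= m < n) (1 + (f m *: u)%:P * 'X) =
          phi (\prod_(1 <= m < n) (1 + f m *: 'X)).
  rewrite /phi !rmorph_prod; apply: eq_bigr => m _.
  rewrite !rmorphD !rmorph1 /= map_polyZ map_polyX comp_polyZ comp_polyX.
  by rewrite -[f m *: u]mul_polyC polyCM -mulrA mul_polyC.
rewrite fg poly_def /phi !rmorph_sum; apply: eq_bigr => i _.
rewrite /= map_polyZ map_polyXn comp_polyZ comp_Xn_poly exprMn.
by rewrite -[g i *: _]mul_polyC polyCM -mulrA polyC_exp mul_polyC.
Qed.

Lemma coef_prod_sum (T : comNzRingType) (n m l : nat) (h : 'I_m -> 'I_n -> T) :
  (\prod_(a < m) \sum_(i < n) (h a i)%:P * 'X^i)`_l =
  \sum_(f : {ffun 'I_m -> 'I_n} | (\sum_(a < m) f a)%N == l)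
    \prod_(a < m) h a (f a).
Proof.
rewrite bigA_distr_bigA coef_sum [RHS]big_mkcond /=; apply: eq_bigr => f _.
rewrite big_split /= prodrXr -rmorph_prod /= coefCM coefXn eq_sym.
by case: ifP => _; rewrite ?mulr1 ?mulr0.
Qed.

(** The sign s covers both patterns (1-t, -t) and (t-1, t): since s * s = 1, it can be moved between
    the weights and u, v. The constant c is kept apart from g because it collects to c^(m+1). *)
Lemma zbar_tE_sum_indices (F : fieldType) (q : F) (n k l : nat) (s c : F)
    (g : nat -> F) (u v : {poly F}) :
  (0 < n)%N -> (0 < k)%N -> (forall m, (0 < m < n)%N -> 1 - q ^+ m != 0) ->
  s * s = 1 -> u = s *: (1 - 'X) -> v = s *: (- 'X) ->
  \prod_(1 <= m < n) (1 + (s * weight q k m) *: 'X) = \poly_(i < n) (c * g i) ->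
  zbar_t n (nseq l k) q =
  \sum_(m < l.+1) ((-1) ^+ m * c ^+ m.+1) *:
    \sum_(i in sum_indices n l m)
       (\prod_(a < m.+1) g (i a)) *: (u ^+ i ord0 * v ^+ (l - i ord0)).
Proof.
move=> n_gt0 k_gt0 qn0 ss u_def v_def prodg; rewrite zbar_tE //.
pose A := \sum_(i < n) (c * g i *: u ^+ i)%:P * 'X^i.
pose B := \sum_(i < n) (c * g i *: v ^+ i)%:P * 'X^i.
have AE : \prod_(1 <= m < n) (1 + (weight q k m *: (1 - 'X))%:P * 'X) = A.
  rewrite /A -(rescaled_product u (g := fun i => c * g i) prodg) //.
  apply: eq_bigr => m _.
  by rewrite u_def scalerA mulrAC ss mul1r.
have BE : \prod_(1 <= m < n) (1 - (weight q k m *: 'X)%:P * 'X) = B.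
  rewrite /B -(rescaled_product v (g := fun i => c * g i) prodg) //.
  apply: eq_bigr => m _.
  by rewrite v_def scalerA mulrAC ss mul1r scalerN polyCN mulNr.
have g0 : c * g 0%N = 1.
  have /(congr1 (fun p : {poly F} => p.[0])) := prodg.
  rewrite horner_prod big1 => [|m _]; last first.
    by rewrite hornerD hornerZ hornerX hornerC mulr0 addr0.
  by rewrite horner_coef0 coef_poly n_gt0.
have B0 : B`_0 = 1.
  rewrite coef_sum (bigD1 (Ordinal n_gt0)) //= g0 !expr0 mulr1 coefC /=.
  rewrite scale1r big1 ?addr0 // => i; rewrite -val_eqE /= => /negPf i0.
  by rewrite coefCM coefXn eq_sym i0 mulr0.
have /(coef_quotient B0) : forall i, (i <= l)%N ->
   (B * \poly_(l' < l.+1) rep_sum q n k n l')`_i = A`_i.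
  by move=> i il; rewrite -AE -BE rep_sum_series // n_gt0 leqnn.
rewrite coef_poly ltnSn => ->; apply: eq_bigr => m _.
(* Factor 0 comes from A, the others from 1 - B. The latter has no constant term, which is the
   origin of the constraint i_a >= 1 for a > 0. *)
pose h (a : 'I_m.+1) (i : 'I_n) : {poly F} :=
  if a == ord0 then c * g i *: u ^+ i
  else (0 < i)%N%:R * (c * g i *: v ^+ i).
have BE' : 1 - B = - \sum_(i < n) ((0 < i)%N%:R * (c * g i *: v ^+ i))%:P * 'X^i.
  rewrite /B (bigD1 (Ordinal n_gt0)) // [in RHS](bigD1 (Ordinal n_gt0)) //=.
  rewrite g0 !expr0 scale1r mulr1 mul0r mul0r add0r opprD addrA subrr add0r.
  congr (- _); apply: eq_bigr => i; rewrite -val_eqE /= -lt0n => ->.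
  by rewrite mul1r.
have -> : A * (1 - B) ^+ m =
    (-1) ^+ m * \prod_(a < m.+1) \sum_(i < n) (h a i)%:P * 'X^i.
  rewrite big_ord_recl BE' [in LHS]exprNn mulrCA; congr (_ * (_ * _)).
  rewrite -[in LHS](card_ord m) -prodr_const; apply: eq_bigr => a _.
  by rewrite /h -val_eqE.
rewrite -(rmorph_sign polyC) coefCM coef_prod_sum -scalerA -2!(signr_odd _ m).
rewrite scaler_sign mulr_sign.
suff -> : \sum_(f : {ffun 'I_m.+1 -> 'I_n} | (\sum_(a < m.+1) f a)%N == l)
    \prod_(a < m.+1) h a (f a) =
  c ^+ m.+1 *: \sum_(i in sum_indices n l m)
       (\prod_(a < m.+1) g (i a)) *: (u ^+ i ord0 * v ^+ (l - i ord0)) by [].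
rewrite (bigID (fun f : {ffun 'I_m.+1 -> 'I_n} =>
  [forall a, (a != ord0) ==> (0 < f a)%N])) /= addrC big1 ?add0r; last first.
  move=> f /andP[_ /forallPn[a]]; rewrite negb_imply => /andP[a0 fa].
  by rewrite (bigD1 a) //= /h (negPf a0) (negPf fa) !mul0r.
rewrite scaler_sumr; apply: eq_big => [f|f /andP[/eqP fl /forallP f_gt0]].
  by rewrite inE.
have -> : (l - f ord0)%N = (\sum_(a < m) f (lift ord0 a))%N.
  by rewrite -[X in (X - _)%N]fl big_ord_recl addKn.
have -> : c ^+ m.+1 = \prod_(a < m.+1) c by rewrite prodr_const card_ord.
rewrite scalerA -big_split /=.
rewrite !big_ord_recl /h eqxx -scalerAl -[in RHS]scalerA [in RHS]scalerAr; congr (_ *: (_ * _)).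
rewrite -prodrXr -scaler_prod; apply: eq_bigr => a _.
by have := f_gt0 (lift ord0 a); rewrite -val_eqE /= => ->; rewrite mul1r.
Qed.

(** * Products over the n-th roots of unity *)

Lemma eq_poly_nonzero (F : numFieldType) (p q : {poly F}) :
  (forall c, c != 0 -> p.[c] = q.[c]) -> p = q.
Proof.
move=> pq; apply/eqP; rewrite -subr_eq0; apply/eqP.
(* In characteristic zero 1, 2, 3, ... are distinct and nonzero, which gives more roots of p - q
   than its degree allows. *)
pose rs := [seq i.+1%:R : F | i <- iota 0 (size (p - q))].
apply: (@roots_geq_poly_eq0 _ _ rs); last by rewrite size_map size_iota.
  apply/allP => _ /mapP[i _ ->]; rewrite rootE hornerD hornerN.
  by rewrite pq ?subrr // Num.Theory.pnatr_eq0.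
rewrite map_inj_uniq ?iota_uniq // => i j /eqP.
by rewrite Num.Theory.eqr_nat eqSS => /eqP.
Qed.

Section RootOfUnity.

Variables (F : numFieldType) (n : nat) (z : F).
Hypotheses (n_gt0 : (0 < n)%N) (prim_z : n.-primitive_root z).

Lemma one_sub_root_neq0 m : (0 < m < n)%N -> 1 - z ^+ m != 0.
Proof.
case/andP=> m0 mn; rewrite subr_eq0 eq_sym -(prim_order_dvd prim_z).
by rewrite gtnNdvd.
Qed.

(** Divide X^n - 1 by X - 1 and evaluate at 1. *)
Lemma prod_one_sub_root : \prod_(1 <= m < n) (1 - z ^+ m) = n%:R.
Proof.
have := factor_Xn_sub_1 prim_z; rewrite big_ltn // expr0 subrX1.
move/(mulfI _)=> /(_ (negbT (polyXsubC_eq0 1)))/(congr1 (fun p => p.[1])).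
rewrite horner_prod; under eq_bigr do rewrite hornerXsubC.
move=> ->; rewrite horner_sum; under eq_bigr do rewrite hornerXn expr1n.
by rewrite sumr_const card_ord.
Qed.

Lemma prod_one_sub_mul_root (a : F) :
  \prod_(0 <= m < n) (1 - a * z ^+ m) = 1 - a ^+ n.
Proof.
have [->|a0] := eqVneq a 0.
  rewrite big1 => [|m _]; last by rewrite mul0r subr0.
  by rewrite expr0n gtn_eqF // subr0.
have /(congr1 (fun p => a ^+ n * p.[a^-1])) := factor_Xn_sub_1 prim_z.
rewrite horner_prod hornerD hornerXn hornerN hornerC mulrBr -exprMn divff //.
rewrite expr1n mulr1 => <-.
have -> : a ^+ n = \prod_(0 <= m < n) a by rewrite prodr_const_nat subn0.
rewrite -big_split /=.
by apply: eq_bigr => m _; rewrite hornerXsubC mulrBr divff.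
Qed.

(* The factor c on the left is the term m = 0 on the right. *)
Lemma prod_weight_clear (k : nat) (c : F) : (0 < k)%N ->
  \prod_(1 <= m < n) (1 + c * weight z k m) * n%:R ^+ k * c =
  \prod_(0 <= m < n) ((1 - z ^+ m) ^+ k + c * z ^+ (k.-1 * m)).
Proof.
move=> k_gt0; rewrite [RHS]big_ltn // muln0 !expr0 subrr expr0n gtn_eqF //.
rewrite add0r mulr1 mulrC; congr (_ * _).
rewrite -prod_one_sub_root -prodrXl -big_split /=.
rewrite !big_nat; apply: eq_bigr => m mn.
by rewrite mulrDl mul1r -mulrA divfK // expf_neq0 // one_sub_root_neq0.
Qed.

(** The two sides are compared at each nonzero c after multiplying by n^k s c, as
    [prod_weight_clear] requires; hence the factor s n^k and the exponent i+1 in the hypothesis. *)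
Lemma prod_weight_poly (k : nat) (s b : F) (g : nat -> F) : (0 < k)%N ->
  s != 0 ->
  (forall c, c != 0 ->
     \prod_(0 <= m < n) ((1 - z ^+ m) ^+ k + s * c * z ^+ (k.-1 * m)) =
     s * n%:R ^+ k * b * \sum_(i < n) g i * c ^+ i.+1) ->
  \prod_(1 <= m < n) (1 + (s * weight z k m) *: 'X) = \poly_(i < n) (b * g i).
Proof.
move=> k_gt0 s0 prodE; apply: eq_poly_nonzero => c c0.
have nk0 : n%:R ^+ k != 0 :> F.
  by rewrite expf_neq0 // Num.Theory.pnatr_eq0 gtn_eqF.
apply: (mulIf (mulf_neq0 nk0 (mulf_neq0 s0 c0))).
rewrite mulrA horner_prod.
under eq_bigr => m _ do rewrite hornerD hornerZ hornerC hornerX mulrAC.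
rewrite prod_weight_clear // prodE // horner_poly !mulr_suml mulr_sumr.
by apply: eq_bigr => i _; rewrite exprS; ring.
Qed.

End RootOfUnity.

(** * Finite differences and power sums of the roots of (x-1)^k = c x^s *)

Section Differences.

Variable F : comNzRingType.

Definition diff (f : nat -> F) (n : nat) : F := f n.+1 - f n.

Lemma eq_iter_diff k (f g : nat -> F) n :
  f =1 g -> iter k diff f n = iter k diff g n.
Proof. by move=> fg; elim: k n => [|k IH] n //=; rewrite /diff !IH. Qed.

Lemma iter_diffD k (f g : nat -> F) n :
  iter k diff (fun n => f n + g n) n = iter k diff f n + iter k diff g n.
Proof. by elim: k n => [|k IH] n //=; rewrite /diff !IH opprD addrACA. Qed.

Lemma iter_diffZ k (c : F) (f : nat -> F) n :
  iter k diff (fun n => c * f n) n = c * iter k diff f n.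
Proof. by elim: k n => [|k IH] n //=; rewrite /diff !IH mulrBr. Qed.

Lemma iter_diff_cst k (c : F) n : (0 < k)%N -> iter k diff (fun=> c) n = 0.
Proof.
case: k => // k _; elim: k n => [|k IH] n; first by rewrite /= /diff subrr.
by rewrite iterS /diff !IH subrr.
Qed.

Lemma iter_diff_sum k (I : Type) (r : seq I) (f : I -> nat -> F) n :
  iter k diff (fun n => \sum_(i <- r) f i n) n =
  \sum_(i <- r) iter k diff (f i) n.
Proof. by elim: k n => [|k IH] n //=; rewrite /diff !IH sumrB. Qed.

Lemma iter_diff_exp k (x : F) n :
  iter k diff (GRing.exp x) n = (x - 1) ^+ k * x ^+ n.
Proof.
elim: k n => [|k IH] n; first by rewrite mul1r.
by rewrite iterS /diff !IH !exprS; ring.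
Qed.

Lemma iter_diff_bin k a m n :
  iter k diff (fun n => 'C(n + a, m + k)%:R) n = 'C(n + a, m)%:R :> F.
Proof.
elim: k m n => [|k IH] m n; first by rewrite addn0.
by rewrite iterS /diff -addSnnS !IH addSn binS natrD addrAC subrr add0r.
Qed.

(** The k-th difference at n combines f n, ..., f (n + k), the last with coefficient 1. *)
Lemma iter_diff_eq0 k (f : nat -> F) n :
  (forall i, (i < k)%N -> f (n + i)%N = 0) -> iter k diff f n = f (n + k)%N.
Proof.
elim: k f => [|k IH] f f0; first by rewrite addn0.
rewrite iterSr IH => [|i ik]; rewrite /diff -addnS; last by rewrite !f0 ?subrr // ltnW.
by rewrite (f0 k) // subr0.
Qed.

(* Equal to (n / j) 'C(n + s j - 1, k j - 1) for j > 0; this form has integer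
   coefficients and makes the recurrence in n an instance of Pascal's rule.
   For j > 0 the predecessors are not truncated as soon as s, k > 0. *)
Definition power_sum_coef (k s n j : nat) : F :=
  if j is _.+1 then
    k%:R * 'C(n + s * j, k * j)%:R - s%:R * 'C((n + s * j).-1, (k * j).-1)%:R
  else k%:R.

Lemma power_sum_coef_small k s n j : (0 < s < k)%N -> (n < j)%N ->
  power_sum_coef k s n j = 0.
Proof.
case: j => // j /andP[s0 sk] nj.
have lt : (n + s * j.+1 < k * j.+1)%N.
  by rewrite (leq_trans _ (leq_mul sk (leqnn j.+1))) // mulSn ltn_add2r.
rewrite /power_sum_coef !bin_small ?mulr0 ?subrr //.
have sj0 : (0 < n + s * j.+1)%N by rewrite addn_gt0 muln_gt0 s0 orbT.
by rewrite -ltnS !prednK // (ltn_trans sj0).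
Qed.

(** By Pascal's rule k differences lower both bottom indices by k, and the top n + s(j+1) regroups
    as (n+s) + sj. *)
Lemma iter_diff_power_sum_coef k s n j : (0 < s)%N -> (0 < k)%N ->
  iter k diff (fun n => power_sum_coef k s n j.+1) n =
  power_sum_coef k s (n + s) j.
Proof.
case: s k => [//|s] [//|k] _ _.
pose f1 n : F := 'C(n + s.+1 * j.+1, k.+1 * j + k.+1)%:R.
pose f2 n : F := 'C(n + (s + s.+1 * j), k.+1 * j + k)%:R.
rewrite (@eq_iter_diff _ _ (fun n => k.+1%:R * f1 n + (- s.+1%:R) * f2 n)); last first.
  move=> i; rewrite /power_sum_coef /f1 /f2 mulNr.
  by rewrite (mulnSr k.+1) (mulnS s.+1) !(addnS, addSn).
rewrite iter_diffD !iter_diffZ iter_diff_bin.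
(* For j = 0 the bottom index of [f2] is one less than the number of differences, so that term
   dies. *)
case: j @f1 @f2 => [|j] f1 f2.
  rewrite !muln0 bin0 mulr1 iterS /diff /f2 !muln0 !iter_diff_bin !bin0.
  by rewrite subrr mulr0 addr0.
have E : (k.+1 * j.+1 + k = (k.+1 * j.+1).-1 + k.+1)%N by rewrite mulnS addnS addSn.
rewrite /f2 E iter_diff_bin /power_sum_coef mulNr.
by rewrite (mulnS s.+1 j.+1) addnA (addnS n s) [in RHS]addSn addnA.
Qed.

(* Both sides satisfy [iter k diff T n = c * T (n + s)]. *)
Lemma power_sumE k s (c : F) (r : seq F) n : (0 < s < k)%N ->
  {in r, forall x, (x - 1) ^+ k = c * x ^+ s} ->
  (forall i, (i < k)%N ->
    \sum_(x <- r) x ^+ i = \sum_(j < i.+1) c ^+ j * power_sum_coef k s i j) ->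
  \sum_(x <- r) x ^+ n = \sum_(j < n.+1) c ^+ j * power_sum_coef k s n j.
Proof.
move=> s_gt0k rP init; case/andP: (s_gt0k) => s_gt0 sk; have k_gt0 := ltn_trans s_gt0 sk.
(* Differences in n need a number of terms independent of n; the added terms vanish by
   [power_sum_coef_small]. *)
pose S N n := \sum_(j < N) c ^+ j * power_sum_coef k s n j.
have SE N m : (m < N)%N -> S m.+1 m = S N m.
  move=> mN; rewrite /S -!(big_mkord xpredT (fun j => c ^+ j * power_sum_coef k s m j)).
  rewrite [RHS](big_cat_nat (n := m.+1)) //= [X in _ + X]big_nat.
  by rewrite [X in _ + X]big1 ?addr0 // => j /andP[mj _]; rewrite power_sum_coef_small ?mulr0.
suff H N m : (m < N)%N -> \sum_(x <- r) x ^+ m = S N m.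
  by rewrite -/(S n.+1 n) (H n.+1).
elim/ltn_ind: m => m IH mN.
have [mk|km] := ltnP m k; first by rewrite init // -SE.
have {}IH i : (i < k)%N -> \sum_(x <- r) x ^+ (m - k + i) = S N (m - k + i)%N.
  move=> ik; apply: IH; first by rewrite -[X in (_ < X)%N](subnK km) ltn_add2l.
  by apply: leq_trans mN; rewrite ltnW // ltnS -[X in (_ < X)%N](subnK km) ltn_add2l.
apply/eqP; rewrite -subr_eq0; apply/eqP.
(* This defect vanishes at the k arguments before m, so its value at m is its k-th difference at m -
   k. *)
pose f i := \sum_(x <- r) x ^+ i + (-1) * S N i.
rewrite -mulN1r -/(f m) -(subnK km) -iter_diff_eq0; last first.
  by move=> i /IH E; rewrite /f E mulN1r subrr.
rewrite iter_diffD iter_diffZ iter_diff_sum mulN1r; apply/eqP; rewrite subr_eq0.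
have -> : \sum_(x <- r) iter k diff (GRing.exp x) (m - k)%N =
          c * \sum_(x <- r) x ^+ (m - k + s).
  rewrite mulr_sumr; apply: eq_big_seq => x xr.
  by rewrite iter_diff_exp rP // -mulrA -exprD addnC.
rewrite IH // /S iter_diff_sum; apply/eqP.
have lt : (m - k + s < N.-1)%N.
  rewrite -ltnS (ltn_predK mN); apply: leq_trans mN.
  by rewrite ltnS -[X in (_ <= X)%N](subnK km) -addnS leq_add2l.
case: N mN lt {IH f} => // N mN /= lt.
(* The term j = 0 is constant in n and disappears; shifting j in the others brings out the factor
   c. *)
rewrite [RHS]big_ord_recl iter_diffZ iter_diff_cst // mulr0 add0r.
rewrite -/(S N.+1 _) -SE; last by rewrite ltnS ltnW.
rewrite (SE N) // /S mulr_sumr; apply: eq_bigr => j _.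
by rewrite iter_diffZ iter_diff_power_sum_coef // exprS mulrA.
Qed.

End Differences.

(** With j = i+1, absorption gives kj C(n+sj, kj) = (n+sj) C(n+sj-1, kj-1); after division by j the
    part with s cancels. *)
Lemma power_sum_coefS (F : numFieldType) k s n i : (0 < k)%N -> (0 < s)%N ->
  power_sum_coef F k s n i.+1 =
  n%:R * (1 / (i + 1)%:R * 'C((n + s * i.+1).-1, (k * i.+1).-1)%:R).
Proof.
case: k s => [//|k] [//|s] _ _; rewrite /power_sum_coef addn1.
have i0 : i.+1%:R != 0 :> F by rewrite Num.Theory.pnatr_eq0.
have := mul_bin_diag (n + s.+1 * i.+1) (k.+1 * i.+1).-1.
rewrite prednK ?muln_gt0 // => /(congr1 (fun m => m%:R : F)).
rewrite !natrM natrD natrM => E.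
apply: (mulfI i0); rewrite mulrBr mulrCA mulrA -E.
by field; rewrite nat1r.
Qed.

(** * The coefficients of E for k = 1, 2, 3 *)

Section ElementarySymmetricFunctions.

Variables (F : numClosedFieldType) (n : nat) (z : F).
Hypotheses (n_gt0 : (0 < n)%N) (prim_z : n.-primitive_root z).

Lemma prod_weight1 :
  \prod_(1 <= m < n) (1 + (1 * weight z 1 m) *: 'X) =
  \poly_(i < n) (n%:R^-1 * ('C(n, i + 1))%:R).
Proof.
apply: (prod_weight_poly n_gt0 prim_z) => // [|c c0]; first exact: oner_neq0.
rewrite expr1 !mul1r mulfV ?Num.Theory.pnatr_eq0 -?lt0n // mul1r.
(* Each factor (1 - z^m) + c is X - z^m at X = 1 + c. *)
have := congr1 (fun p => p.[1 + c]) (factor_Xn_sub_1 prim_z).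
rewrite horner_prod hornerD hornerXn hornerN hornerC exprDn big_ord_recl.
rewrite !expr0 !expr1n mul1r bin0 mulr1n addrAC subrr add0r => E.
transitivity (\prod_(0 <= i < n) ('X - (z ^+ i)%:P).[1 + c]).
  by apply: eq_bigr => m _; rewrite hornerXsubC expr1 mul0n mulr1 addrAC.
rewrite E; apply: eq_bigr => i _.
by rewrite expr1n mul1r /= /bump /= add1n addn1 -mulr_natl.
Qed.

Lemma quadratic_root (b c : F) : exists x, x ^+ 2 = b * x + c.
Proof.
have [x xE] := solve_monicpoly (fun i => if i == 0%N then c else b) (ltn0Sn 1).
by exists x; rewrite xE !big_ord_recl big_ord0 /= expr0 expr1 mulr1 addr0 addrC.
Qed.

Lemma prod_weight2 :
  \prod_(1 <= m < n) (1 + (- 1 * weight z 2 m) *: 'X) =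
  \poly_(i < n) (n%:R^-1 * (1 / (i + 1)%:R * ('C(n + i, 2 * i + 1))%:R)).
Proof.
apply: (prod_weight_poly n_gt0 prim_z) => // [|c c0].
  by rewrite oppr_eq0 oner_neq0.
(* The factorization (1-x)^2 - c x = (1-ax)(1-bx) means ab = 1 and a + b = 2 + c; both a and b then
   satisfy (x-1)^2 = c x. *)
have [a aE] := quadratic_root (2 + c) (-1).
pose b := 2 + c - a.
have ab : a * b = 1.
  have -> : a * b = (2 + c) * a - a ^+ 2 by rewrite /b; ring.
  by rewrite aE; ring.
have -> : \prod_(0 <= m < n)
      ((1 - z ^+ m) ^+ 2 + -1 * c * z ^+ (2.-1 * m)) =
    \prod_(0 <= m < n) ((1 - a * z ^+ m) * (1 - b * z ^+ m)).
  apply: eq_bigr => m _; rewrite mul1n.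
  have -> : (1 - a * z ^+ m) * (1 - b * z ^+ m) =
    1 - (a + b) * z ^+ m + a * b * z ^+ m ^+ 2 by ring.
  by rewrite ab /b; ring.
rewrite big_split /= !(prod_one_sub_mul_root n_gt0 prim_z).
have -> : (1 - a ^+ n) * (1 - b ^+ n) = 2 - \sum_(x <- [:: a; b]) x ^+ n.
  rewrite !big_cons big_nil addr0.
  have -> : (1 - a ^+ n) * (1 - b ^+ n) = 1 - (a ^+ n + b ^+ n) + (a * b) ^+ n.
    by rewrite exprMn; ring.
  by rewrite ab expr1n; ring.
rewrite (@power_sumE _ 2 1 c) //; last first.
- case=> [|[|//]] _; rewrite !big_cons big_nil !big_ord_recr big_ord0 /=.
    by rewrite !expr0; ring.
  rewrite /power_sum_coef (_ : 'C(1 + 1 * 1, 2 * 1) = 1%N) //.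
  by rewrite (_ : 'C(_, _) = 1%N) // /b; ring.
- move=> x; rewrite !inE => /orP[] /eqP ->.
    have -> : (a - 1) ^+ 2 = a ^+ 2 - 2 * a + 1 by ring.
    by rewrite aE; ring.
  have -> : (b - 1) ^+ 2 = a ^+ 2 - 2 * (1 + c) * a + (1 + c) ^+ 2.
    by rewrite /b; ring.
  by rewrite aE /b; ring.
(* The term j = 0 of the power sum is k = 2 and cancels the constant. *)
rewrite big_ord_recl expr0 mul1r opprD addrA subrr add0r mulr_sumr -sumrN.
have n0 : n%:R != 0 :> F by rewrite Num.Theory.pnatr_eq0 -lt0n.
apply: eq_bigr => i _; rewrite lift0 power_sum_coefS //.
rewrite !addn1 mul1n addnS mulnS add2n /=.
by field; rewrite n0 nat1r Num.Theory.pnatr_eq0.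
Qed.

(** These symmetric functions express (1-x)^3 - c x^2 = (1-ax)(1-bx)(1-dx). After one root a of the
    cubic, b and d come from the quadratic with sum 3 - a and product 1/a. *)
Lemma cubic_roots (c : F) : exists a b d : F,
  [/\ a * b * d = 1, a + b + d = 3 & a * b + a * d + b * d = 3 - c].
Proof.
have [a aE] := solve_monicpoly
  (fun i => if i == 0%N then 1 else if i == 1%N then c - 3 else 3) (ltn0Sn 2).
have {}aE : a ^+ 3 = 1 + (c - 3) * a + 3 * a ^+ 2.
  by rewrite aE !big_ord_recl big_ord0 /= expr0 expr1 mulr1 addr0 addrA.
have a0 : a != 0.
  apply/eqP => a0; move/eqP: aE.
  by rewrite a0 !expr0n /= !mulr0 !addr0 eq_sym oner_eq0.
have [b bE] := quadratic_root (3 - a) (- a^-1).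
have bd : b * (3 - a - b) = a^-1.
  have -> : b * (3 - a - b) = (3 - a) * b - b ^+ 2 by ring.
  by rewrite bE; ring.
exists a, b, (3 - a - b); split; first by rewrite -mulrA bd divff.
  by ring.
rewrite bd; apply: (mulfI a0).
have -> : a * (a * b + a * (3 - a - b) + a^-1) = 1 + 3 * a ^+ 2 - a ^+ 3.
  by field.
by rewrite aE; ring.
Qed.

Lemma prod_weight3 :
  \prod_(1 <= m < n) (1 + (- 1 * weight z 3 m) *: 'X) =
  \poly_(i < n) ((n%:R ^+ 2)^-1 * (1 / (i + 1)%:R *
    (('C(n + i, 3 * i + 2))%:R + (-1) ^+ i * ('C(n + 2 * i + 1, 3 * i + 2))%:R))).
Proof.
apply: (prod_weight_poly n_gt0 prim_z) => // [|c c0].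
  by rewrite oppr_eq0 oner_neq0.
have [a [b [d [e3 e1 e2]]]] := cubic_roots c.
have -> : \prod_(0 <= m < n)
      ((1 - z ^+ m) ^+ 3 + -1 * c * z ^+ (3.-1 * m)) =
    \prod_(0 <= m < n)
      ((1 - a * z ^+ m) * (1 - b * z ^+ m) * (1 - d * z ^+ m)).
  apply: eq_bigr => m _; rewrite mulnC exprM.
  have -> : (1 - a * z ^+ m) * (1 - b * z ^+ m) * (1 - d * z ^+ m) =
    1 - (a + b + d) * z ^+ m + (a * b + a * d + b * d) * z ^+ m ^+ 2
    - a * b * d * z ^+ m ^+ 3 by ring.
  by rewrite e1 e2 e3; ring.
rewrite !big_split /= !(prod_one_sub_mul_root n_gt0 prim_z).
(* As abd = 1, the outer terms 1 and -(abd)^n cancel, leaving two power sums. *)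
have -> : (1 - a ^+ n) * (1 - b ^+ n) * (1 - d ^+ n) =
    \sum_(x <- [:: a * b; a * d; b * d]) x ^+ n - \sum_(x <- [:: a; b; d]) x ^+ n.
  rewrite !big_cons !big_nil !addr0.
  have -> : (1 - a ^+ n) * (1 - b ^+ n) * (1 - d ^+ n) =
    (a * b) ^+ n + ((a * d) ^+ n + (b * d) ^+ n)
    - (a ^+ n + (b ^+ n + d ^+ n)) + 1 - (a * b * d) ^+ n.
    by rewrite !exprMn; ring.
  by rewrite e3 expr1n addrK.
have cubeE x : (x - 1) ^+ 3 - c * x =
    (x - a) * (x - b) * (x - d) + (a + b + d - 3) * x ^+ 2
    - (a * b + a * d + b * d - (3 - c)) * x + (a * b * d - 1) by ring.
(* u v = (product of the roots) / w, the inverse of a root. *)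
have cube2E u v w : a * b * d = u * v * w ->
    a * b + a * d + b * d = u * v + u * w + v * w ->
    a + b + d = u + v + w -> (u * v - 1) ^+ 3 = - c * (u * v) ^+ 2.
  rewrite e1 e2 e3 => E3 E2 E1; apply/eqP; rewrite -subr_eq0; apply/eqP.
  have -> : (u * v - 1) ^+ 3 - - c * (u * v) ^+ 2 =
     (u * v + u * w + v * w - (3 - c)) * (u * v) ^+ 2
     - (u * v * w * (u + v + w) - 3) * (u * v)
     + ((u * v * w) ^+ 2 - 1) by ring.
  by rewrite -E1 -E2 -E3; ring.
(* The pairwise products satisfy (x-1)^3 = -c x^2; they give the second binomial with its sign
   (-1)^i. *)
rewrite (@power_sumE _ 3 2 (- c)) //; last first.
- case=> [|[|[|//]]] _; rewrite !big_cons big_nil !big_ord_recr big_ord0 /=.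
  + by rewrite !expr0; ring.
  + have -> : (a * b) ^+ 1 + ((a * d) ^+ 1 + ((b * d) ^+ 1 + 0)) =
      a * b + a * d + b * d by ring.
    rewrite e2 /power_sum_coef (_ : 'C(1 + 2 * 1, 3 * 1) = 1%N) //.
    by rewrite (_ : 'C(_, _) = 1%N) //; ring.
  + have -> : (a * b) ^+ 2 + ((a * d) ^+ 2 + ((b * d) ^+ 2 + 0)) =
      (a * b + a * d + b * d) ^+ 2 - 2 * (a * b * d) * (a + b + d) by ring.
    rewrite e1 e2 e3 /power_sum_coef.
    rewrite (_ : 'C(2 + 2 * 1, 3 * 1) = 4%N) //.
    rewrite (_ : 'C((2 + 2 * 1).-1, (3 * 1).-1) = 3%N) //.
    rewrite (_ : 'C(2 + 2 * 2, 3 * 2) = 1%N) //.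
    by rewrite (_ : 'C((2 + 2 * 2).-1, (3 * 2).-1) = 1%N) //; ring.
- move=> x; rewrite !inE => /or3P[] /eqP ->.
  + by apply: (cube2E a b d).
  + by apply: (cube2E a d b); ring.
  + by apply: (cube2E b d a); ring.
(* The roots satisfy (x-1)^3 = c x and give the first binomial. *)
rewrite (@power_sumE _ 3 1 c) //; last first.
- case=> [|[|[|//]]] _; rewrite !big_cons big_nil !big_ord_recr big_ord0 /=.
  + by rewrite !expr0; ring.
  + have -> : a ^+ 1 + (b ^+ 1 + (d ^+ 1 + 0)) = a + b + d by ring.
    rewrite e1 /power_sum_coef (_ : 'C(1 + 1 * 1, 3 * 1) = 0%N) //.
    by rewrite (_ : 'C(_, _) = 0%N) //; ring.
  + have -> : a ^+ 2 + (b ^+ 2 + (d ^+ 2 + 0)) =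
      (a + b + d) ^+ 2 - 2 * (a * b + a * d + b * d) by ring.
    rewrite e1 e2 /power_sum_coef.
    rewrite (_ : 'C(2 + 1 * 1, 3 * 1) = 1%N) //.
    rewrite (_ : 'C((2 + 1 * 1).-1, (3 * 1).-1) = 1%N) //.
    rewrite (_ : 'C(2 + 1 * 2, 3 * 2) = 0%N) //.
    by rewrite (_ : 'C((2 + 1 * 2).-1, (3 * 2).-1) = 0%N) //; ring.
- move=> x xr; apply/eqP; rewrite expr1 -subr_eq0 cubeE e1 e2 e3 !subrr.
  by move: xr; rewrite !inE => /or3P[] /eqP ->; rewrite subrr; apply/eqP; ring.
rewrite !(big_ord_recl n) !expr0 !mul1r opprD addrACA subrr add0r -sumrB mulr_sumr.
have n0 : n%:R != 0 :> F by rewrite Num.Theory.pnatr_eq0 -lt0n.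
apply: eq_bigr => i _; rewrite !lift0 !power_sum_coefS //.
rewrite mul1n addnS !mulnS !(addSn, addnS, add0n, addn0) /= [(- c) ^+ _]exprNn !exprS.
by field; rewrite n0 nat1r Num.Theory.pnatr_eq0.
Qed.

End ElementarySymmetricFunctions.

Theorem corollary1p5 (R : realType) (n : nat) (n_gt0 : (0 < n)%N)
    (zeta : complex R) (prim_zeta : n.-primitive_root zeta) (l : nat) :
  [/\ zbar_t n (nseq l 1%N) zeta =
        \sum_(m < l.+1)
          ((-1) ^+ m / n%:R ^+ m.+1) *:
          \sum_(i in sum_indices n l m)
            (\prod_(a < m.+1) ('C(n, i a + 1))%:R) *:
            ((1 - 'X) ^+ i ord0 * (- 'X) ^+ (l - i ord0)),
      zbar_t n (nseq l 2%N) zeta =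
        \sum_(m < l.+1)
          ((-1) ^+ m / n%:R ^+ m.+1) *:
          \sum_(i in sum_indices n l m)
            (\prod_(a < m.+1)
               (1 / (i a + 1)%:R * ('C(n + i a, 2 * i a + 1))%:R)) *:
            (('X - 1) ^+ i ord0 * 'X ^+ (l - i ord0))
    & zbar_t n (nseq l 3%N) zeta =
        \sum_(m < l.+1)
          ((-1) ^+ m / n%:R ^+ (2 * m + 2)) *:
          \sum_(i in sum_indices n l m)
            (\prod_(a < m.+1)
               (1 / (i a + 1)%:R
                * (('C(n + i a, 3 * i a + 2))%:R
                   + (-1) ^+ i a * ('C(n + 2 * i a + 1, 3 * i a + 2))%:R))) *:
            (('X - 1) ^+ i ord0 * 'X ^+ (l - i ord0))].
Proof.
have qn0 := one_sub_root_neq0 prim_zeta.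
have N1 : (-1) * (-1) = 1 :> complex R by rewrite mulrNN mulr1.
(* The sign is s = -1 for k = 2 and 3, and s = 1 for k = 1. *)
have uE : 'X - 1 = (-1) *: (1 - 'X) :> {poly complex R} by rewrite scaleN1r opprB.
have vE : 'X = (-1) *: - 'X :> {poly complex R} by rewrite scaleN1r opprK.
split.
- rewrite (zbar_tE_sum_indices l n_gt0 _ qn0 _ _ _ (prod_weight1 n_gt0 prim_zeta)
    (u := 1 - 'X) (v := - 'X)) ?mul1r ?scale1r //.
  by apply: eq_bigr => m _; rewrite exprVn.
- rewrite (zbar_tE_sum_indices l n_gt0 _ qn0 N1 uE vE (prod_weight2 n_gt0 prim_zeta)) //.
  by apply: eq_bigr => m _; rewrite exprVn.
- rewrite (zbar_tE_sum_indices l n_gt0 _ qn0 N1 uE vE (prod_weight3 n_gt0 prim_zeta)) //.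
  by apply: eq_bigr => m _; rewrite exprVn -exprM mulnS addnC.
Qed.
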